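(* Let $k$ be a nonnegative integer. Then for every integer $n\ge 0$, $$\sum_{|\lambda|=n}\frac{2^{|\lambda|-\ell(\lambda)}f_{\lambda}}{H_{\lambda}}\sum_{\square\in\lambda}\binom{c_{\square}+k-1}{2k}=\frac{2^k}{(k+1)!}\binom{n}{k+1},$$ where the outer sum ranges over all strict partitions $\lambda$ of size $n$.
   Context: A strict partition is a finite strictly decreasing sequence of positive integers $\lambda=(\lambda_1>\lambda_2>\cdots>\lambda_\ell)$ (the empty sequence is allowed); $|\lambda|=\sum_i\lambda_i$ is its size, $\ell(\lambda)=\ell$ its length, and $\lambda_i=0$ for $i>\ell(\lambda)$. The (shifted Young) diagram of $\lambda$ is the set of boxes $(i,j)$ with $1\le i\le \ell(\lambda)$ and $i+1\le j\le i+\lambda_i$ (row $i$, column $j$); $\lambda$ is identified with its diagram. The content of a box $\square=(i,j)$ is $c_\square=j-i$. The hook length $h_\square$ of $\square=(i,j)\in\lambda$ is the number of boxes of $\lambda$ in row $i$ strictly to the right of $\square$, plus the number of boxes $(i',j)\in\lambda$ with $i'>i$, plus $1$, plus $\lambda_j$. $H_\lambda=\prod_{\square\in\lambda}h_\square$. $f_\lambda$ is the number of standard shifted Young tableaux of shape $\lambda$, i.e. bijective fillings of the boxes of $\lambda$ with $1,\dots,|\lambda|$ increasing from left to right along rows and from top to bottom along columns. $\binom{z}{2k}=z(z-1)\cdots(z-2k+1)/(2k)!$. *)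

(* Defs.v *)
From mathcomp Require Import all_boot all_order all_algebra.
Set Implicit Arguments. Unset Strict Implicit. Unset Printing Implicit Defensive.
Import Order.TTheory GRing.Theory Num.Theory.

Definition is_strict (l : seq nat) : bool := sorted gtn l && all (fun x => 0 < x) l.

(* All strict partitions of n, each listed exactly once: every strict partition
   of n has distinct parts in {1..n}, hence is the decreasing sort of a subset
   of 'I_n.+1. *)
Definition strict_parts (n : nat) : seq (seq nat) :=
  [seq l <- undup [seq sort geq [seq val i | i <- enum A] | A : {set 'I_n.+1}]
     | is_strict l && (sumn l == n)].

(* lambda_i, 1-indexed; 0 for i > length *)
Definition part (l : seq nat) (i : nat) : nat := if i is 0 then 0 else nth 0 l i.-1.

Definition diagram (l : seq nat) : seq (nat * nat) :=
  [seq (i, j) | i <- iota 1 (size l), j <- iota i.+1 (part l i)].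

(* content c = j - i (always >= 1 for boxes) *)
Definition content (b : nat * nat) : nat := b.2 - b.1.

Definition hook (l : seq nat) (b : nat * nat) : nat :=
  count (fun b' => (b'.1 == b.1) && (b.2 < b'.2)) (diagram l)
  + count (fun b' => (b'.2 == b.2) && (b.1 < b'.1)) (diagram l)
  + 1 + part l b.2.

Definition Hprod (l : seq nat) : nat := \prod_(b <- diagram l) hook l b.

(* A filling t assigns nth 0 t p to the p-th box of (diagram l).
   It is standard if it is a bijection onto {1..|lambda|} (t a permutation of
   iota 1 |lambda|) and increases along rows and down columns. *)
Definition standard_filling (l : seq nat) (t : seq nat) : bool :=
  let D := diagram l in
  [forall p : 'I_(size D), forall q : 'I_(size D),
     (((nth (0,0) D p).1 == (nth (0,0) D q).1) && ((nth (0,0) D p).2 < (nth (0,0) D q).2)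
      ==> (nth 0 t p < nth 0 t q))
     && (((nth (0,0) D p).2 == (nth (0,0) D q).2) && ((nth (0,0) D p).1 < (nth (0,0) D q).1)
      ==> (nth 0 t p < nth 0 t q))].

Definition f_shifted (l : seq nat) : nat :=
  count (standard_filling l) (permutations (iota 1 (sumn l))).

(* Main.v *)
Require Import Defs.
From mathcomp Require Import all_boot all_order all_algebra.
From mathcomp Require Import ring lra zify.
Import Order.TTheory GRing.Theory Num.Theory.
Local Open Scope ring_scope.

(* Write E_n g for the sum of (2^(|l| - len l) f_l / H_l) g(l) over strict l of
   size n. The branching rule for f and the product formula for H give
   E_(n+1) g = E_n (Pg), where P averages over the ways of adding a box; the
   weight of adding a box to a row of length x is the residue at u = x(x+1) of
     R_l(u) = 1/u * prod_j (u - l_j(l_j - 1)) / (u - l_j(l_j + 1)),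
   so the weights sum to 1 and their moments M_m(l) = sum of residue * u^m are
   the coefficients of R_l at infinity. Adding a box with y = c(c-1) multiplies
   R_l by (u-y)^2 / ((u-y)^2 - 2(u-y) - 4y), so in the algebra generated by the
   M_m, with M_m in degree m, the difference g(l + box) - g(l) is a polynomial
   in y of total degree less than deg g, and P - 1 lowers the degree. Hence E_n g
   is polynomial in n of degree at most deg g. As binom(c+k-1, 2k) is a polynomial
   of degree k in y, the sum in question is polynomial in n of degree at most
   k+1; it vanishes for n <= k, where no content exceeds k, and at n = k+1 only
   the one-row partition contributes. *)

(** * Residues and moments *)

Section PartialFractions.
Variables (F : fieldType) (T : eqType) (a b : T -> F) (z : T).

Lemma perm_swap t (s : seq T) : perm_eq (z :: t :: s) (t :: z :: s).
Proof. by rewrite (perm_catCA [:: z] [:: t] s). Qed.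

(* The residues at the [a x] of the rational function
   [prod_(j <- s) (u - b j) / prod_(j <- z :: s) (u - a j)]. *)
Definition residue (s : seq T) (x : T) : F :=
  (\prod_(j <- s) (a x - b j)) / \prod_(j <- z :: s | j != x) (a x - a j).

Definition moment (s : seq T) (m : nat) : F :=
  \sum_(x <- z :: s) residue s x * a x ^+ m.

Lemma residue_perm s t x : perm_eq s t -> residue s x = residue t x.
Proof.
move=> st; rewrite /residue (perm_big _ st); congr (_ / _).
by apply: perm_big; rewrite perm_cons.
Qed.

Lemma moment_perm s t m : perm_eq s t -> moment s m = moment t m.
Proof.
move=> st; rewrite /moment (@perm_big _ _ _ _ _ (z :: t)) ?perm_cons //=.
by apply: eq_bigr => x _; rewrite (residue_perm _ _ _ st).
Qed.

Lemma residue_cons t s x : x != t ->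
  residue (t :: s) x = residue s x * ((a x - b t) / (a x - a t)).
Proof.
move=> xt; rewrite /residue big_cons (perm_big _ (perm_swap _ _)) big_cons.
by rewrite eq_sym xt invfM; ring.
Qed.

Lemma residue_head t s : t \notin z :: s ->
  residue (t :: s) t
  = (a t - b t) * ((\prod_(j <- s) (a t - b j)) / \prod_(j <- z :: s) (a t - a j)).
Proof.
move=> tzs; rewrite /residue big_cons.
have -> : \prod_(j <- z :: t :: s | j != t) (a t - a j)
          = \prod_(j <- z :: s) (a t - a j).
  rewrite (perm_big _ (perm_swap _ _)) big_cons eqxx big_seq_cond [RHS]big_seq.
  by apply: eq_bigl => j; case: eqP => [->|_]; rewrite ?andbT // (negPf tzs).
by rewrite mulrA.
Qed.

Lemma big_seq_swap (G : T -> F) t s :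
  \sum_(x <- z :: t :: s) G x = G t + \sum_(x <- z :: s) G x.
Proof. by rewrite !big_cons addrCA. Qed.

Lemma sum_residueE t s (G : T -> F) : t \notin z :: s ->
  \sum_(x <- z :: t :: s) residue (t :: s) x * G x
  = residue (t :: s) t * G t
    + \sum_(x <- z :: s) residue s x * ((a x - b t) / (a x - a t)) * G x.
Proof.
move=> tzs; rewrite big_seq_swap; congr (_ + _).
rewrite big_seq [RHS]big_seq; apply: eq_bigr => x xs.
by rewrite residue_cons //; apply: contraNneq tzs => <-.
Qed.

(** Induction on [s]. A new [t] multiplies the function by [(u - b t) / (u - a t)], and its residue
    at [a t] is [a t - b t] times the value of the old function there. The induction hypothesis,
    applied at [u] and at [a t], leaves an identity for each [x] separately. *)
Lemma partial_fractions s u : uniq (map a (z :: s)) -> u \notin map a (z :: s) ->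
  \sum_(x <- z :: s) residue s x / (u - a x)
  = (\prod_(j <- s) (u - b j)) / \prod_(j <- z :: s) (u - a j).
Proof.
elim: s u => [|t s IH] u /= Ua ua.
  by rewrite /residue !(big_nil, big_cons) eqxx /= invr1 !(mulr1, mul1r, addr0).
have [tzs Us] : a t \notin map a (z :: s) /\ uniq (map a (z :: s)).
  by apply/andP; rewrite -cons_uniq -map_cons -(perm_uniq (perm_map a (perm_swap t s))).
have tzs' : t \notin z :: s by apply: contra tzs => h; apply: map_f.
have [uz ut us] : [/\ u != a z, u != a t & u \notin map a s].
  by move: ua; rewrite !inE !negb_or => /and3P[].
have uzs : u \notin map a (z :: s) by rewrite /= inE negb_or uz.
rewrite sum_residueE // residue_head // -(IH (a t)) //.
have -> : (\prod_(j <- t :: s) (u - b j)) / \prod_(j <- z :: t :: s) (u - a j)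
    = (u - b t) / (u - a t) * ((\prod_(j <- s) (u - b j)) / \prod_(j <- z :: s) (u - a j)).
  by rewrite (perm_big _ (perm_swap t s)) !big_cons !invfM; ring.
rewrite -IH //.
rewrite !mulr_sumr mulr_suml -big_split /= big_seq [RHS]big_seq.
apply: eq_bigr => x xs.
have h1 : u - a x != 0 by rewrite subr_eq0; apply: contraNneq uzs => ->; apply: map_f.
have h2 : a t - a x != 0 by rewrite subr_eq0; apply: contraNneq tzs => ->; apply: map_f.
have h3 : a x - a t != 0 by rewrite -opprB oppr_eq0.
have h4 : u - a t != 0 by rewrite subr_eq0.
by field; rewrite h1 h2 h3 h4.
Qed.

(** The rational function behaves like [1 / u] at infinity. In the induction, the residue at [a t],
    expanded by [partial_fractions], makes up for the change of the other residues: [(a t - b t) /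
    (a t - a x) + (a x - b t) / (a x - a t) = 1]. *)
Lemma moment0 s : uniq (map a (z :: s)) -> moment s 0 = 1.
Proof.
elim: s => [|t s IH] Ua.
  by rewrite /moment /residue !(big_nil, big_cons) eqxx /= invr1 !(mulr1, addr0).
have [tzs Us] : a t \notin map a (z :: s) /\ uniq (map a (z :: s)).
  by apply/andP; rewrite -cons_uniq -map_cons -(perm_uniq (perm_map a (perm_swap t s))).
have tzs' : t \notin z :: s by apply: contra tzs => h; apply: map_f.
rewrite -{}IH // /moment sum_residueE // residue_head // -partial_fractions //.
rewrite mulr_sumr expr0 mulr1 -big_split /= big_seq [RHS]big_seq.
apply: eq_bigr => x xs; rewrite expr0.
have h2 : a t - a x != 0 by rewrite subr_eq0; apply: contraNneq tzs => ->; apply: map_f.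
have h3 : a x - a t != 0 by rewrite -opprB oppr_eq0.
by field; rewrite h2 h3.
Qed.

(** Compares coefficients at infinity in [(u - a t) * R' = (u - b t) * R], where [R'] and [R] are
    the functions of [t :: s] and [s]. *)
Lemma moment_cons t s m : a t \notin map a (z :: s) ->
  moment (t :: s) m.+1 - a t * moment (t :: s) m = moment s m.+1 - b t * moment s m.
Proof.
move=> tzs.
have tzs' : t \notin z :: s by apply: contra tzs => h; apply: map_f.
rewrite /moment !sum_residueE //.
rewrite mulrDr !mulr_sumr opprD addrACA mulrCA -exprS subrr add0r -!sumrB.
rewrite big_seq [RHS]big_seq; apply: eq_bigr => x xs.
have h3 : a x - a t != 0 by rewrite subr_eq0; apply: contraNneq tzs => <-; apply: map_f.
by rewrite !exprS; field.
Qed.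

End PartialFractions.

Arguments perm_swap {T}.
Arguments residue {F T}.
Arguments moment {F T}.

(* Adding a box to a row of length [x] (or starting a row, [x = 0]) creates a box
   of content [c = x + 1], and [outer x = c * (c - 1)]; likewise [inner x] is
   [c * (c - 1)] for the last box, of content [c = x], of a row of length [x]. *)
Definition outer (x : nat) : rat := x%:R * (x%:R + 1).
Definition inner (x : nat) : rat := x%:R * (x%:R - 1).

Local Notation M := (moment outer inner 0%N).
Local Notation res := (residue outer inner 0%N).

Lemma outer_inj : injective outer.
Proof.
move=> x y /eqP; rewrite /outer !natr1 -!natrM eqr_nat => /eqP; nia.
Qed.

Lemma moment_nat0 s : uniq (0%N :: s) -> M s 0 = 1.
Proof. by move=> Us; apply: moment0; rewrite map_inj_uniq //; apply: outer_inj. Qed.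

Lemma moment_nat_cons t s m : t \notin 0%N :: s ->
  M (t :: s) m.+1 = outer t * M (t :: s) m + M s m.+1 - inner t * M s m.
Proof.
move=> ts; apply/eqP; rewrite -addrA addrC -subr_eq moment_cons //.
by rewrite mem_map //; apply: outer_inj.
Qed.

(** Put [y = outer x = inner x.+1]. The functions [R'] of [x.+1 :: s] and [R] of [x :: s] satisfy
    [(u - outer x.+1) * (u - inner x) * R' = (u - y)^2 * R]. The two roots on the left have sum
    [2 y + 2] and product [y^2 - 2 y], so [x] enters only through [y]. *)
Lemma moment_step x s m : uniq (0%N :: x :: s) -> uniq (0%N :: x.+1 :: s) ->
  M (x.+1 :: s) m.+2
  = (2 * outer x + 2) * M (x.+1 :: s) m.+1 - (outer x ^+ 2 - 2 * outer x) * M (x.+1 :: s) m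
    + M (x :: s) m.+2 - 2 * outer x * M (x :: s) m.+1 + outer x ^+ 2 * M (x :: s) m.
Proof.
move=> U1 U2; have := perm_uniq (perm_swap 0%N x s).
rewrite U1 => /esym/andP[n1 _]; have := perm_uniq (perm_swap 0%N x.+1 s).
rewrite U2 => /esym/andP[n2 _].
have := moment_nat_cons _ _ m n1; have := moment_nat_cons _ _ m.+1 n1.
have := moment_nat_cons _ _ m n2; have := moment_nat_cons _ _ m.+1 n2.
rewrite /outer /inner -natr1 => e1 e2 e3 e4.
rewrite e1 e3 e4 e2; ring.
Qed.

(** * Adding and removing boxes *)

Section StrictPartitions.
Local Open Scope nat_scope.

Lemma is_strict_cons x l :
  is_strict (x :: l) = [&& 0 < x, all (gtn x) l & is_strict l].
Proof.
rewrite /is_strict /= path_sortedE; last by move=> ? ? ? /= h1 h2; apply: ltn_trans h2 h1.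
by case: (all _ l); case: (sorted _ l); case: (0 < x); case: (all _ l).
Qed.

Lemma is_strict_uniq l : is_strict l -> uniq (0 :: l).
Proof.
elim: l => // x l IH; rewrite is_strict_cons => /and3P[x0 /allP xl /IH].
rewrite cons_uniq => /andP[l0 ul].
rewrite !cons_uniq ul inE negb_or l0 eq_sym -lt0n x0 !andbT /=.
by apply/negP => /xl /=; rewrite ltnn.
Qed.

Lemma size_strict x l : is_strict (x :: l) -> size l < x.
Proof.
elim: l x => [|y l IH] x; rewrite is_strict_cons => /and3P[] // _ /= /andP[yx _] /IH.
by move=> h; apply: leq_ltn_trans h yx.
Qed.

Lemma leq_mem_sumn x l : x \in l -> x <= sumn l.
Proof.
elim: l => //= y l IH; rewrite inE => /orP[/eqP->|/IH h]; first exact: leq_addr.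
exact: leq_trans h (leq_addl _ _).
Qed.

Lemma mem_strict_parts n l :
  (l \in strict_parts n) = is_strict l && (sumn l == n).
Proof.
rewrite mem_filter mem_undup andb_idr // => /andP[sl /eqP sumn_l].
have Ul : uniq l by move: (is_strict_uniq l sl); rewrite cons_uniq => /andP[].
have bound x : x \in l -> x < n.+1 by move=> xl; rewrite ltnS -sumn_l leq_mem_sumn.
set A := [set i : 'I_n.+1 | val i \in l].
have pA : perm_eq [seq val i | i <- enum A] l.
  apply: uniq_perm => // [|x]; first by rewrite map_inj_uniq ?enum_uniq //; apply: val_inj.
  apply/mapP/idP => [[i]|xl]; first by rewrite mem_enum inE => il ->.
  by exists (Ordinal (bound x xl)); rewrite ?mem_enum ?inE.
apply/imageP; exists A => //.
have -> : l = sort geq l.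
  apply/esym/sorted_sort; first by move=> x y z /= h1 h2; apply: leq_trans h2 h1.
  by case/andP: sl => sl _; apply: sub_sorted sl => x y; apply: ltnW.
apply/perm_sortP; rewrite 1?perm_sym //.
- by move=> x y; apply: leq_total.
- by move=> x y z /= h1 h2; apply: leq_trans h2 h1.
- by move=> x y; rewrite andbC => /anti_leq.
Qed.

Lemma strict_parts_uniq n : uniq (strict_parts n).
Proof. by rewrite filter_uniq // undup_uniq. Qed.

(** A row that becomes empty is deleted, since [is_strict] forbids zeros; in a strict partition a
    row of length 1 is the last one. *)
Fixpoint decr_nth (l : seq nat) (i : nat) : seq nat :=
  match l, i with
  | [::], _ => [::]
  | x :: l', 0 => if x == 1 then l' else x.-1 :: l'
  | x :: l', i'.+1 => x :: decr_nth l' i'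
  end.

Lemma incr_nth_split l i : i < size l ->
  incr_nth l i = take i l ++ (nth 0 l i).+1 :: drop i.+1 l.
Proof. by elim: l i => [|x l IH] [|i] //= il; rewrite ?drop0 // IH. Qed.

Lemma incr_nth_rcons l : incr_nth l (size l) = rcons l 1.
Proof. by elim: l => //= x l ->. Qed.

Lemma incr_nthK l i : is_strict l -> i <= size l -> decr_nth (incr_nth l i) i = l.
Proof.
elim: l i => [|x l IH] [|i] //=; rewrite is_strict_cons => /and3P[x0 _ sl].
  by rewrite eqSS -[x == 0]negbK -lt0n x0.
by move=> il; rewrite IH.
Qed.

Lemma decr_nthK l i : is_strict l -> i < size l -> incr_nth (decr_nth l i) i = l.
Proof.
elim: l i => [|x l IH] [|i] //= sxl.
  case: eqP => [x1|] _ /=; last by move: sxl; rewrite is_strict_cons => /andP[]; case: x.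
  by move/size_strict: sxl; rewrite x1; case: l {IH}.
by move: sxl; rewrite is_strict_cons => /and3P[_ _ sl] il; rewrite IH.
Qed.

Lemma size_decr_nth l i : is_strict l -> i < size l -> i <= size (decr_nth l i).
Proof.
elim: l i => [|x l IH] [|i] //= sxl.
by move: sxl; rewrite is_strict_cons => /and3P[_ _ sl] il; apply: IH.
Qed.

Lemma size_incr_nth_gt l i : i < size (incr_nth l i).
Proof. by rewrite size_incr_nth; case: ifP. Qed.

Lemma sumn_incr_nth l i : sumn (incr_nth l i) = (sumn l).+1.
Proof.
elim: l i => [|x l IH] [|i] //=; last by rewrite IH addnS.
by elim: i.
Qed.

Lemma size_le_sumn l : is_strict l -> size l <= sumn l.
Proof.
elim: l => //= x l IH; rewrite is_strict_cons => /and3P[x0 _ /IH]; lia.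
Qed.

Definition up_step (l : seq nat) (i : nat) := (i <= size l) && is_strict (incr_nth l i).
Definition down_step (l : seq nat) (i : nat) := (i < size l) && is_strict (decr_nth l i).

End StrictPartitions.

(** * Hook products *)

Section Hooks.
Local Open Scope nat_scope.

Definition shift_box (b : nat * nat) := (b.1.+1, b.2.+1).

Lemma iotaSl m n : iota m.+1 n = map S (iota m n).
Proof. by rewrite -add1n iotaDl. Qed.

(** Row [i] of a shifted diagram starts in column [i + 1], so the rows after the first form the
    diagram of [s] moved one step along the diagonal. *)
Lemma diagram_cons x s :
  diagram (x :: s) = [seq (1, j) | j <- iota 2 x] ++ map shift_box (diagram s).
Proof.
rewrite /diagram /=; congr (_ ++ _).
rewrite iotaSl map_flatten -!map_comp; congr flatten.
apply/eq_in_map => i; rewrite mem_iota => /andP[i0 _] /=.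
by rewrite iotaSl -!map_comp; case: i i0.
Qed.

Lemma mem_diagram l i j :
  ((i, j) \in diagram l) = [&& 0 < i, i < j & j <= i + part l i].
Proof.
elim: l i j => [|x l IH] i j.
  have -> : part [::] i = 0 by case: i => //= i; rewrite nth_nil.
  rewrite addn0 in_nil; lia.
rewrite diagram_cons mem_cat.
have -> : ((i, j) \in [seq (1, j) | j <- iota 2 x]) = (i == 1) && (2 <= j < 2 + x).
  apply/mapP/andP => [[j' hj [-> ->]]|[/eqP-> hj]]; first by rewrite mem_iota in hj.
  by exists j => //; rewrite mem_iota.
have -> : ((i, j) \in map shift_box (diagram l)) = [&& 0 < i, 0 < j & (i.-1, j.-1) \in diagram l].
  apply/mapP/and3P => [[[i' j'] hb [-> ->]]|[i0 j0 hb]] //.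
  by exists (i.-1, j.-1) => //; rewrite /shift_box !prednK.
rewrite IH; case: i => [|[|i]] //=; rewrite ?andbF ?orbF /=; case: j => [|j] //=; lia.
Qed.

Lemma diagram_uniq l : uniq (diagram l).
Proof.
have inj_row : injective (pair 1 : nat -> nat * nat) by move=> j j' [].
have inj_shift : injective shift_box by move=> [i j] [i' j'] [-> ->].
elim: l => // x l IH; rewrite diagram_cons cat_uniq !map_inj_uniq // iota_uniq IH.
rewrite andbT /=; apply/hasPn => b /mapP[[i j]].
rewrite mem_diagram => /andP[i0 _] ->; apply/negP => /mapP[j' _ [i1]].
by move: i0; rewrite i1.
Qed.

Lemma size_diagram l : size (diagram l) = sumn l.
Proof.
by elim: l => // x l IH; rewrite diagram_cons size_cat !size_map size_iota IH.
Qed.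

Lemma big_content_diagram (R : nmodType) (F : nat -> R) l :
  (\sum_(b <- diagram l) F (content b) = \sum_(x <- l) \sum_(1 <= c < x.+1) F c)%R.
Proof.
elim: l => [|x l IH]; first by rewrite !big_nil.
rewrite diagram_cons big_cat !big_map big_cons -IH; congr (_ + _)%R.
  rewrite iotaSl big_map /index_iota subSS subn0.
  by apply: eq_bigr => c _; rewrite /content /= subSS subn0.
Qed.

Lemma hook_shift x s b : b \in diagram s -> hook (x :: s) (shift_box b) = hook s b.
Proof.
case: b => i j; rewrite mem_diagram => /and3P[i0 ij _].
rewrite /hook diagram_cons !count_cat !count_map.
have -> : forall p, (forall c, p (1, c) = false) ->
  count (preim (fun j : nat => (1, j)) p) (iota 2 x) = 0.
  by move=> p hp; rewrite (eq_count (a2 := pred0)) ?count_pred0 // => c /=; rewrite hp.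
- have -> : forall p, (forall c, p (1, c) = false) ->
    count (preim (fun j : nat => (1, j)) p) (iota 2 x) = 0.
    by move=> p hp; rewrite (eq_count (a2 := pred0)) ?count_pred0 // => c /=; rewrite hp.
  + by congr (_ + _); rewrite /=; case: j ij.
  + by move=> c /=; rewrite andbC; case: i i0 ij.
- by move=> c /=; case: i i0 ij.
Qed.

Lemma Hprod_cons x s :
  Hprod (x :: s) = (\prod_(j <- iota 2 x) hook (x :: s) (1, j)) * Hprod s.
Proof.
rewrite /Hprod [in LHS]diagram_cons big_cat !big_map; congr (_ * _).
by rewrite big_seq [RHS]big_seq; apply: eq_bigr => b /hook_shift.
Qed.

Lemma count_column l j :
  count (fun b => b.2 == j) (diagram l)
  = count (fun i => i < j <= i + part l i) (iota 1 (size l)).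
Proof.
rewrite /diagram count_flatten -sumn_count -map_comp; congr sumn; apply: eq_map => i /=.
rewrite count_map (eq_count (a2 := pred1 j)) //.
by rewrite count_uniq_mem ?iota_uniq // mem_iota; congr nat_of_bool; lia.
Qed.

Lemma hook_first_row x s j : 1 < j <= x.+1 ->
  hook (x :: s) (1, j) = (x.+1 - j) + count (fun i => i < j.-1 <= i + part s i) (iota 1 (size s))
                         + 1 + part (x :: s) j.
Proof.
move=> hj; rewrite /hook diagram_cons !count_cat -count_column; congr (_ + _ + 1 + _).
  rewrite !count_map [X in _ + X](eq_in_count (a2 := pred0)) ?count_pred0 ?addn0; last first.
    by move=> [i j'] /=; rewrite mem_diagram => /andP[]; case: i.
  rewrite (eq_count (a2 := fun c => j < c)) // -size_filter.
  have -> : [seq c <- iota 2 x | j < c] = iota j.+1 (x.+1 - j).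
    apply: (sorted_eq ltn_trans) => [c d /andP[]|||]; first by lia.
    - by apply: sorted_filter (iota_ltn_sorted _ _); apply: ltn_trans.
    - exact: iota_ltn_sorted.
    - apply: uniq_perm; rewrite ?filter_uniq ?iota_uniq // => c.
      by rewrite mem_filter !mem_iota; lia.
  by rewrite size_iota.
rewrite !count_map [X in X + _](eq_count (a2 := pred0)) ?count_pred0 ?add0n; last first.
  by move=> c /=; rewrite andbF.
apply: eq_in_count => -[i j'] /=; rewrite mem_diagram => /andP[i0 _] /=.
by rewrite ltnS i0 andbT; case: j hj.
Qed.

(** [i + part l i] is the last column of row [i]. As the parts are positive and strictly decreasing,
    part [i] is at least the number of rows from [i] on. *)
Lemma strict_part_bound l i : is_strict l -> 0 < i <= size l -> size l < i + part l i.
Proof.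
elim: l i => [|x l IH] i; first by case: i.
move=> sxl; case: i => [|[|i]] //= hi; first by have := size_strict _ _ sxl; lia.
move: sxl; rewrite is_strict_cons => /and3P[_ _ sl].
by have := IH i.+1 sl hi; rewrite addSn ltnS.
Qed.

(** The [j] lower rows that start no later than this column all reach it, so arm and leg add up to
    [x - 1]; the term [part] supplies [nth 0 s j]. *)
Lemma hook_first_row_short x s j : is_strict (x :: s) -> j < size s ->
  hook (x :: s) (1, j.+2) = x + nth 0 s j.
Proof.
move=> sxs js; have xs := size_strict _ _ sxs.
rewrite hook_first_row; last by lia.
have -> : count (fun i => i < j.+1 <= i + part s i) (iota 1 (size s)) = j.
  rewrite (eq_in_count (a2 := fun i => i < j.+1)).
    rewrite -(subnKC (ltnW js)) iotaD count_cat.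
    rewrite (eq_in_count (a2 := predT)) ?count_predT ?size_iota; last by move=> i; rewrite mem_iota /=; lia.
    rewrite (eq_in_count (a2 := pred0)) ?count_pred0 ?addn0 // => i; rewrite mem_iota /=; lia.
  move=> i; rewrite mem_iota => hi; rewrite andb_idr // => _.
  have ss : is_strict s by move: sxs; rewrite is_strict_cons => /and3P[].
  by have := strict_part_bound _ i ss; lia.
by rewrite /=; lia.
Qed.

Lemma hook_first_row_long x s d : is_strict (x :: s) -> d < x - size s ->
  hook (x :: s) (1, x.+1 - d) = d.+1 + count (fun i => x - part s i <= d + i) (iota 1 (size s)).
Proof.
move=> sxs ds; have xs := size_strict _ _ sxs.
rewrite hook_first_row; last by lia.
have -> : part (x :: s) (x.+1 - d) = 0 by rewrite /part subSn ?nth_default //=; lia.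
rewrite addn0 addn1 subKn; last by lia.
rewrite -addSn; congr (_ + _).
apply: eq_in_count => i; rewrite mem_iota; lia.
Qed.

Lemma strict_part_anti l i i' : is_strict l -> 0 < i <= i' -> i' <= size l ->
  i' + part l i' <= i + part l i.
Proof.
elim: l i i' => [|x l IH] i i'; first by case: i'; case: i.
rewrite is_strict_cons => /and3P[x0 /allP xl sl].
case: i' => [|[|i']]; case: i => [|[|i]] //= hi hi'; last by have := IH i.+1 i'.+1 sl hi hi'; rewrite /=; lia.
have := IH 1 i'.+1 sl isT hi'; have /= := xl (part l 1) (mem_nth 0 (leq_ltn_trans (leq0n i') hi')).
rewrite /=; lia.
Qed.

(* [d] indexes the columns [x.+1 - d > size s + 1], for which the term [part l j]
   of the hook length vanishes. *)
Lemma hook_first_row_perm x s : is_strict (x :: s) ->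
  perm_eq ([seq hook (x :: s) (1, x.+1 - d) | d <- iota 0 (x - size s)] ++ [seq x - y | y <- s])
          (iota 1 x).
Proof.
move=> sxs; have xs := size_strict _ _ sxs.
have := sxs; rewrite is_strict_cons => /and3P[_ /allP /= s_lt ss].
have s_gt0 y : y \in s -> 0 < y by case/andP: ss => _ /allP; apply.
have s_uniq : uniq s by move: (is_strict_uniq _ ss); rewrite cons_uniq => /andP[].
set cnt := fun d => count (fun i => x - part s i <= d + i) (iota 1 (size s)).
have hE : {in iota 0 (x - size s), (fun d => hook (x :: s) (1, x.+1 - d)) =1 (fun d => d.+1 + cnt d)}.
  by move=> d; rewrite mem_iota => hd; apply: hook_first_row_long.
move/eq_in_map: hE => ->.
have cnt_mono d d' : d <= d' -> cnt d <= cnt d'.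
  by move=> dd'; apply: sub_count => i /= hi; apply: leq_trans hi _; rewrite leq_add2r.
have cnt_size d : cnt d <= size s by rewrite -[size s](size_iota 1) count_size.
(* The hook lengths avoid every [x - part s i]. If row [i] of [s] reaches the column, so do the rows
   above it and [cnt d] is at least [i]; otherwise no row from [i] on reaches it and [cnt d] is at
   most [i - 1]. *)
have cntP i d : 0 < i <= size s -> d.+1 + cnt d != x - part s i.
  move=> hi; have anti j j' := strict_part_anti _ j j' ss.
  case: (leqP (x - part s i) (d + i)) => hx.
    suff : i <= cnt d by lia.
    rewrite /cnt; have -> : size s = i + (size s - i) by lia.
    rewrite iotaD count_cat (eq_in_count (a2 := predT)) ?count_predT ?size_iota ?leq_addr // => j.
    by rewrite mem_iota => hj; have := anti j i; rewrite /=; lia.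
  suff : cnt d <= i.-1 by lia.
  rewrite /cnt; have -> : size s = i.-1 + (size s - i.-1) by lia.
  rewrite iotaD count_cat [X in _ + X](eq_in_count (a2 := pred0)).
    by rewrite count_pred0 addn0 -[X in _ <= X](size_iota 1) count_size.
  by move=> j; rewrite mem_iota => hj; have := anti i j; rewrite /=; lia.
set L := _ ++ _.
have UL : uniq L.
  rewrite cat_uniq !map_inj_in_uniq ?iota_uniq ?s_uniq //.
  - rewrite andbT /=; apply/hasPn => _ /mapP[y ys ->]; apply/mapP => -[d _ e].
    have /(nthP 0)[i hi yi] := ys; have := cntP i.+1 d hi.
    by rewrite /= yi e eqxx.
  - by move=> y y' /s_lt h /s_lt h'; lia.
  - move=> d d' _ _ e; case: (ltngtP d d') => // h; have := cnt_mono _ _ (ltnW h); lia.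
have subL : {subset L <= iota 1 x}.
  move=> v; rewrite mem_cat mem_iota => /orP[] /mapP.
    by move=> [d]; rewrite mem_iota => hd ->; have := cnt_size d; lia.
  by move=> [y /[dup] /s_lt h /s_gt0 h'] ->; lia.
(* [L] has [x] distinct entries between 1 and [x], hence exhausts this interval. *)
have [|_ eqL] := uniq_min_size UL subL; last by apply: uniq_perm; rewrite ?iota_uniq.
by rewrite size_cat !size_map !size_iota; lia.
Qed.

(** By [hook_first_row_perm] the remaining hooks of the row, together with the differences [x - y],
    multiply to [x!]; the [size s] leftmost hooks are the sums [x + y]. *)
Lemma hook_first_row_prod x s : is_strict (x :: s) ->
  (\prod_(j <- iota 2 x) hook (x :: s) (1, j)) * \prod_(y <- s) (x - y)
  = x`! * \prod_(y <- s) (x + y).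
Proof.
move=> sxs; have xs := size_strict _ _ sxs.
have -> : x`! = \prod_(v <- iota 1 x) v by rewrite fact_prod /index_iota subSS subn0.
rewrite -(perm_big _ (hook_first_row_perm _ _ sxs)) big_cat !big_map /= mulnAC; congr (_ * _).
rewrite -{1}(subnKC (ltnW xs)) iotaD big_cat mulnC /=; congr (_ * _); last first.
  rewrite (_ : iota _ (x - size s) = rev [seq x.+1 - d | d <- iota 0 (x - size s)]); last first.
    apply: (@eq_from_nth _ 0) => [|i]; rewrite ?size_rev ?size_map !size_iota // => hi.
    rewrite nth_iota // nth_rev ?size_map ?size_iota // (nth_map 0) ?size_iota ?nth_iota //; lia.
  by rewrite (perm_big _ (permEl (perm_rev _))) big_map.
rewrite 2!iotaSl !big_map [RHS](big_nth 0) /index_iota subn0 big_seq [RHS]big_seq.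
by apply: eq_bigr => j; rewrite mem_iota => js; rewrite hook_first_row_short.
Qed.

End Hooks.

(** * Transition weights *)

Section Weights.

Lemma strict_rem s1 x s2 : is_strict (s1 ++ x :: s2) -> is_strict (s1 ++ s2).
Proof.
elim: s1 => [|t s1 IH] /=; first by rewrite is_strict_cons => /and3P[].
rewrite !is_strict_cons !all_cat /= => /and3P[-> /and3P[-> _ ->] h] /=.
exact: IH.
Qed.

(** Iterated over the rows, this is the product formula for the hook product: the factorials of the
    parts times [(l_i + l_j) / |l_i - l_j|] over pairs of parts. The absolute value makes it
    symmetric in the parts, so that [Hprod_split] can take out any row. *)
Lemma Hprod_cons_rat x s : is_strict (x :: s) ->
  (Hprod (x :: s))%:R
  = (Hprod s)%:R * (x`!%:R * \prod_(y <- s) ((x%:R + y%:R) / `|x%:R - y%:R|)) :> rat.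
Proof.
move=> sxs; rewrite Hprod_cons natrM mulrC; congr (_ * _).
have := sxs; rewrite is_strict_cons => /and3P[_ /allP /= s_lt _].
have /(congr1 (fun n => n%:R : rat)) := hook_first_row_prod _ _ sxs.
rewrite !natrM prodf_div !natr_prod => e.
have e1 : \prod_(y <- s) (x - y)%N%:R = \prod_(y <- s) `|x%:R - y%:R| :> rat.
  rewrite big_seq [RHS]big_seq; apply: eq_bigr => y /s_lt yx.
  by rewrite natrB ?(ltnW yx) ?ger0_norm // subr_ge0 ler_nat (ltnW yx).
have e2 : \prod_(y <- s) (x + y)%N%:R = \prod_(y <- s) (x%:R + y%:R) :> rat.
  by apply: eq_bigr => y _; rewrite natrD.
rewrite -e1 -e2 mulrA -e mulfK // e1 prodf_seq_neq0; apply/allP => y /s_lt yx /=.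
by rewrite normr_eq0 subr_eq0 eqr_nat gtn_eqF.
Qed.

Lemma Hprod_split s1 x s2 : is_strict (s1 ++ x :: s2) ->
  (Hprod (s1 ++ x :: s2))%:R
  = (Hprod (s1 ++ s2))%:R
    * (x`!%:R * \prod_(y <- s1 ++ s2) ((x%:R + y%:R) / `|x%:R - y%:R|)) :> rat.
Proof.
elim: s1 => [|t s1 IH] /= sl; first exact: Hprod_cons_rat.
have sl' := strict_rem (t :: s1) x s2 sl.
rewrite !Hprod_cons_rat // IH; last by move: sl; rewrite is_strict_cons => /and3P[].
by rewrite !big_cat !big_cons /= (addrC x%:R t%:R) (distrC x%:R t%:R) big_cat /=; ring.
Qed.

Lemma perm_incr_nth l i : (i < size l)%N ->
  let s := take i l ++ drop i.+1 l in
  perm_eq l (nth 0%N l i :: s) /\ perm_eq (incr_nth l i) ((nth 0%N l i).+1 :: s).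
Proof.
move=> il s; rewrite incr_nth_split // -[X in perm_eq X _](cat_take_drop i) (drop_nth 0%N il).
by rewrite !(perm_catCA _ [:: _]).
Qed.

(** After [Hprod_split] takes the changed row out of the hook products, their quotient is compared
    with the residue part by part. *)
Lemma residue_incr l i : is_strict l -> up_step l i ->
  (2 ^ (i < size l))%N%:R * (Hprod l)%:R
  = residue outer inner 0%N l (nth 0%N l i) * (Hprod (incr_nth l i))%:R.
Proof.
move=> sl /andP[]; rewrite leq_eqVlt => /orP[/eqP->|il] sl'.
  rewrite ltnn mul1r nth_default // incr_nth_rcons.
  move: sl'; rewrite incr_nth_rcons -cats1 => sl'.
  rewrite Hprod_split // cats0 mul1r mulrCA -[LHS]mulr1; congr (_ * _).
  have : uniq [:: 0, 1 & l]%N.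
    by rewrite -(perm_uniq (s1 := 0%N :: l ++ [:: 1%N])) ?is_strict_uniq // perm_cons perm_catC.
  rewrite /= !inE => /and3P[/norP[_ l0] l1 _].
  rewrite /residue big_cons eqxx /=.
  have -> : \prod_(j <- l | j != 0%N) (outer 0 - outer j) = \prod_(j <- l) (outer 0 - outer j).
    rewrite big_seq_cond [RHS]big_seq; apply: eq_bigl => j.
    by case: eqP => [->|_]; rewrite ?andbT // (negPf l0).
  rewrite -prodf_div -big_split /= big_seq big1 // => y yl.
  have y1 : (1 < y)%N by case: y yl => [|[|]] // h; [rewrite h in l0|rewrite h in l1].
  have h : 1 < y%:R :> rat by rewrite ltr1n.
  rewrite distrC ger0_norm; last by lra.
  by rewrite /outer /inner; field; apply/andP; split; [|apply/andP; split]; apply/eqP; lra.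
have [pl pl'] := perm_incr_nth l i il; move: pl pl'.
set x := nth 0%N l i; set s := _ ++ _ => pl pl'.
have U1 : uniq [:: 0, x & s]%N.
  by rewrite -(perm_uniq (s1 := 0%N :: l)) ?is_strict_uniq // perm_cons.
have U2 : uniq [:: 0, x.+1 & s]%N.
  by rewrite -(perm_uniq (s1 := 0%N :: incr_nth l i)) ?is_strict_uniq // perm_cons.
have [x0s _] : x \notin 0%N :: s /\ uniq (0%N :: s).
  by apply/andP; rewrite -cons_uniq -(perm_uniq (perm_swap 0%N x s)).
have [x1s _] : x.+1 \notin 0%N :: s /\ uniq (0%N :: s).
  by apply/andP; rewrite -cons_uniq -(perm_uniq (perm_swap 0%N x.+1 s)).
rewrite (residue_perm _ _ _ _ _ _ _ _ pl) residue_head // big_cons.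
have el : take i l ++ x :: drop i.+1 l = l by rewrite -(drop_nth 0%N il) cat_take_drop.
have := incr_nth_split _ _ il; rewrite -/x => el'.
have := Hprod_split (take i l) x (drop i.+1 l); rewrite el => -> //.
have := Hprod_split (take i l) x.+1 (drop i.+1 l); rewrite -el' => -> //.
rewrite -/x -/s il expn1 factS natrM.
(* Here [outer x - inner y = (x + y) * (x + 1 - y)] and [outer x - outer y = (x - y) * (x + y + 1)].
   As [y] is neither [x] nor [x + 1], the differences [x - y] and [x + 1 - y] have the same sign. *)
rewrite (_ : \prod_(y <- s) ((x%:R + y%:R) / `|x%:R - y%:R|)
  = \prod_(j <- s) (outer x - inner j) / \prod_(j <- s) (outer x - outer j)
    * \prod_(y <- s) ((x.+1%:R + y%:R) / `|x.+1%:R - y%:R|)); last first.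
  rewrite -prodf_div -big_split /= big_seq [RHS]big_seq; apply: eq_bigr => y ys.
  have yx : y != x by apply: contraNneq x0s => <-; rewrite inE ys orbT.
  have yx1 : y != x.+1 by apply: contraNneq x1s => <-; rewrite inE ys orbT.
  have y0 : 0 <= y%:R :> rat by apply: ler0n.
  have x0 : 0 <= x%:R :> rat by apply: ler0n.
  have ne : outer x - outer y != 0 by rewrite subr_eq0 (inj_eq outer_inj) eq_sym.
  move: ne; rewrite -natr1 /outer /inner => ne.
  have [h|h] : (y < x)%N \/ (x.+1 < y)%N.
    case: (ltngtP y x) yx => // h _; first by left.
    by right; rewrite ltn_neqAle eq_sym yx1.
    have h' : y%:R < x%:R :> rat by rewrite ltr_nat.
    rewrite !ger0_norm; try lra.
    by field; rewrite ne andTb; apply/andP; split; apply/eqP; lra.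
  have h' : x%:R + 1 < y%:R :> rat by rewrite natr1 ltr_nat.
  rewrite !ler0_norm; try lra.
  by field; rewrite ne andTb; apply/andP; split; apply/eqP; lra.
have x0 : (0 < x)%N by move: x0s; rewrite inE negb_or -lt0n => /andP[].
have x0' : 0 < x%:R :> rat by rewrite ltr0n.
rewrite -natr1 invfM; set P := (\prod_(j <- s) (outer x - outer j))^-1.
(* The factors for the row itself and for the pole at 0 give [2 / (x + 1)]: the 2 is the power of
   two, and [x + 1] is the quotient of the factorials. *)
have -> : outer x - inner x = 2 * x%:R by rewrite /outer /inner; ring.
have -> : outer x - outer 0 = x%:R * (x%:R + 1) by rewrite /outer; ring.
by field; rewrite -?natr1; apply/andP; split; apply/eqP; lra.
Qed.

Lemma strict_incr_blocked l i : is_strict l -> (i <= size l)%N -> ~~ is_strict (incr_nth l i) ->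
  (nth 0%N l i).+1 \in l.
Proof.
elim: l i => [|x l IH] [|i] //=.
  rewrite !is_strict_cons => /and3P[_ /allP xl ->] _; rewrite andbT => /allPn[y /xl /= yx].
  by rewrite ltnS ltnW.
move=> sxl il; move: (sxl); rewrite !is_strict_cons => /and3P[-> /allP /= xl sl] /=.
rewrite negb_and => /orP[/allPn[y]|/(IH _ sl il) h]; last by rewrite inE h orbT.
have [->|il'] := eqVneq i (size l).
  rewrite incr_nth_rcons mem_rcons inE => /orP[/eqP->|yl] /=; last by rewrite xl.
  move: sxl; rewrite is_strict_cons => /and3P[x0 _ _]; rewrite -leqNgt => x1.
  by rewrite nth_default // inE eqn_leq x0 x1.
have {il'} il : (i < size l)%N by rewrite ltn_neqAle il'.
have [pl pl'] := perm_incr_nth l i il.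
rewrite (perm_mem pl') inE => /orP[/eqP->|ys] /=.
  rewrite -leqNgt => h; rewrite inE eqn_leq h andbT.
  by apply/orP; left; apply: xl; apply: mem_nth.
by rewrite xl // (perm_mem pl) inE ys orbT.
Qed.

(** The part [x + 1] that blocks a row of length [x] contributes the factor
    [outer x - inner x.+1 = 0]. Sums over addable boxes thus extend to all rows. *)
Lemma residue_blocked l i : is_strict l -> (i <= size l)%N -> ~~ is_strict (incr_nth l i) ->
  residue outer inner 0%N l (nth 0%N l i) = 0.
Proof.
move=> sl il nsl; have h := strict_incr_blocked l i sl il nsl.
rewrite /residue (perm_big _ (perm_to_rem h)) big_cons.
have -> : outer (nth 0%N l i) - inner (nth 0%N l i).+1 = 0 by rewrite /outer /inner -natr1; ring.
by rewrite /= !mul0r.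
Qed.

End Weights.

(** * Branching rule for shifted tableaux *)

Section LinearExtensions.
Local Open Scope nat_scope.
Variables (T : eqType) (x0 : T) (R : rel T).

Definition monotone_filling (D : seq T) (t : seq nat) : bool :=
  [forall p : 'I_(size D), forall q : 'I_(size D),
     R (nth x0 D p) (nth x0 D q) ==> (nth 0 t p < nth 0 t q)].

Definition linear_extensions (D : seq T) : nat :=
  count (monotone_filling D) (permutations (iota 1 (size D))).

Definition insert (p v : nat) (t : seq nat) := take p t ++ v :: drop p t.

Definition delete (p : nat) (D : seq T) := take p D ++ drop p.+1 D.

Lemma monotone_fillingP D t :
  reflect (forall p q, p < size D -> q < size D -> R (nth x0 D p) (nth x0 D q) ->
             nth 0 t p < nth 0 t q) (monotone_filling D t).
Proof.
apply: (iffP forallP) => [h p q hp hq|h p].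
  by have /forallP/(_ (Ordinal hq))/implyP := h (Ordinal hp).
by apply/forallP => q; apply/implyP; apply: h.
Qed.

Lemma perm_insert p v t : perm_eq (insert p v t) (v :: t).
Proof. by rewrite /insert (perm_catCA _ [:: v]) /= perm_cons cat_take_drop. Qed.

Lemma index_insert p v t : v \notin t -> p <= size t -> index v (insert p v t) = p.
Proof.
move=> vt pt; rewrite /insert index_cat.
have /negPf -> : v \notin take p t by apply: contra vt; apply: mem_take.
by rewrite /= eqxx addn0 size_takel.
Qed.

Lemma rem_insert p v t : v \notin t -> rem v (insert p v t) = t.
Proof.
rewrite /insert; elim: t p => [|y t IH] [|p] /=; rewrite ?eqxx //.
rewrite inE eq_sym => /norP[yv vt].
by rewrite (negPf yv) IH.
Qed.

Lemma insert_rem v t : v \in t -> insert (index v t) v (rem v t) = t.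
Proof.
rewrite /insert; elim: t => [|y t IH] //=; rewrite inE.
by case: eqVneq => [->|_] /=; [rewrite take0 drop0 | move=> /IH ->].
Qed.

(** A permutation of [1..n+1] is determined by the position of [n+1] and by what is left after
    removing it. *)
Lemma perm_permutations_insert n :
  perm_eq (permutations (iota 1 n.+1))
          [seq insert p n.+1 t | p <- iota 0 n.+1, t <- permutations (iota 1 n)].
Proof.
have nin t : perm_eq t (iota 1 n) -> n.+1 \notin t.
  by move=> pt; rewrite (perm_mem pt) mem_iota; lia.
have psz t : perm_eq t (iota 1 n) -> size t = n by move/perm_size; rewrite size_iota.
have iotaE : perm_eq (iota 1 n.+1) (n.+1 :: iota 1 n).
  by rewrite -[X in iota 1 X]addn1 iotaD add1n perm_catC.
apply: uniq_perm; first exact: permutations_uniq.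
- apply: allpairs_uniq; rewrite ?iota_uniq ?permutations_uniq // => -[p t] [p' t'].
  move=> /allpairsPdep[a [b [ha hb [-> ->]]]] /allpairsPdep[c [d [hc hd [-> ->]]]] /= e.
  move: ha hb hc hd; rewrite !mem_iota !mem_permutations => ha hb hc hd.
  have e2 : b = d by rewrite -(rem_insert a n.+1 b) ?nin // e rem_insert ?nin.
  have e1 : a = c by rewrite -(index_insert a n.+1 b) ?nin ?psz // e index_insert ?nin ?psz //.
  by rewrite e1 e2.
move=> t; rewrite mem_permutations; apply/idP/allpairsPdep => [pt|[p [t' []]]].
  have nt : n.+1 \in t by rewrite (perm_mem pt) mem_iota; lia.
  exists (index n.+1 t), (rem n.+1 t); split; last by rewrite insert_rem.
    by rewrite mem_iota /= add0n -[X in _ < X](size_iota 1) -(perm_size pt) index_mem.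
  rewrite mem_permutations -(perm_cons n.+1); apply: perm_trans iotaE.
  by apply: perm_trans pt; rewrite perm_sym perm_to_rem.
rewrite mem_permutations => _ pt' ->; apply: perm_trans (perm_insert _ _ _) _.
by rewrite perm_sym; apply: perm_trans iotaE _; rewrite perm_cons perm_sym.
Qed.

Lemma nth_insert_bump p v t i : p <= size t -> nth 0 (insert p v t) (bump p i) = nth 0 t i.
Proof.
move=> pt; rewrite /insert nth_cat size_takel // /bump.
case: (leqP p i) => pi; last by rewrite add0n pi nth_take.
have -> : 1 + i < p = false by lia.
by rewrite add1n subSn //= nth_drop subnKC.
Qed.

Lemma nth_insert p v t : p <= size t -> nth 0 (insert p v t) p = v.
Proof. by move=> pt; rewrite /insert nth_cat size_takel // ltnn subnn. Qed.

Lemma nth_delete p D i : p < size D -> nth x0 (delete p D) i = nth x0 D (bump p i).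
Proof.
move=> pt; rewrite /delete nth_cat size_takel ?(ltnW pt) // /bump.
case: (leqP p i) => pi; last by rewrite add0n nth_take.
by rewrite nth_drop; congr nth; rewrite addSn subnKC.
Qed.

Lemma size_delete p D : p < size D -> size (delete p D) = (size D).-1.
Proof. by move=> pt; rewrite size_cat size_takel ?size_drop; lia. Qed.

(** The inserted [n+1] exceeds all other entries, so the only constraints it can violate are those
    that ask for a larger entry than the one at [p]. *)
Lemma monotone_filling_insert D n p t :
  size D = n.+1 -> p < n.+1 -> perm_eq t (iota 1 n) ->
  monotone_filling D (insert p n.+1 t)
  = all (fun y => ~~ R (nth x0 D p) y) D && monotone_filling (delete p D) t.
Proof.
move=> sD pn pt; have st : size t = n by rewrite (perm_size pt) size_iota.
have pD : p < size D by rewrite sD.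
have pst : p <= size t by rewrite st.
have t_le i : nth 0 t i < n.+1.
  case: (ltnP i (size t)) => hi; last by rewrite nth_default.
  by have := mem_nth 0 hi; rewrite (perm_mem pt) mem_iota add1n => /andP[].
have bumpE i : i != p -> i < size D -> exists2 j, j < size (delete p D) & i = bump p j.
  move=> ip iD; exists (unbump p i); last by rewrite unbumpK.
  by rewrite size_delete // /unbump; case: (ltngtP p i) ip => // pi _; lia.
have bump_lt j : j < size (delete p D) -> bump p j < size D.
  by rewrite size_delete // /bump; lia.
apply/monotone_fillingP/andP => [h|[/allP hmax /monotone_fillingP h] i j iD jD].
  split.
    apply/allP => y /(nthP x0)[q qD <-]; apply/negP => /(h _ _ pD qD).
    rewrite nth_insert //; have [->|qp] := eqVneq q p; first by rewrite nth_insert ?ltnn.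
    have [j _ ->] := bumpE _ qp qD; rewrite nth_insert_bump //.
    by have := t_le j; lia.
  apply/monotone_fillingP => i j /bump_lt iD /bump_lt jD; rewrite !nth_delete //.
  by move/(h _ _ iD jD); rewrite !nth_insert_bump.
have [->|ip] := eqVneq i p; first by rewrite (negPf (hmax _ (mem_nth x0 jD))).
have [i' i'D ->] := bumpE _ ip iD; rewrite nth_insert_bump //.
have [->|jp] := eqVneq j p; first by rewrite nth_insert.
have [j' j'D ->] := bumpE _ jp jD; rewrite nth_insert_bump //.
by rewrite -!nth_delete //; apply: h.
Qed.

(* The largest entry of a filling sits at a maximal element. *)
Lemma linear_extensions_rec D : 0 < size D ->
  linear_extensions D
  = \sum_(p <- iota 0 (size D) | all (fun y => ~~ R (nth x0 D p) y) D)
       linear_extensions (delete p D).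
Proof.
case E : (size D) => [//|n] _; rewrite {1}/linear_extensions E.
rewrite (permP (perm_permutations_insert n)) count_flatten sumnE.
rewrite !big_map [RHS]big_mkcond big_seq [RHS]big_seq; apply: eq_bigr => p.
rewrite mem_iota add0n => /andP[_ pn]; rewrite count_map.
rewrite (eq_in_count (a2 := fun t => all (fun y => ~~ R (nth x0 D p) y) D && monotone_filling (delete p D) t)); last first.
  by move=> t; rewrite mem_permutations => pt; apply: monotone_filling_insert.
case: ifP => _ /=; last by rewrite count_pred0.
by rewrite /linear_extensions size_delete ?E.
Qed.
End LinearExtensions.

(** * Removable corners of shifted diagrams *)

Section ShiftedTableaux.
Local Open Scope nat_scope.

Definition box_lt (b b' : nat * nat) : bool :=
  ((b.1 == b'.1) && (b.2 < b'.2)) || ((b.2 == b'.2) && (b.1 < b'.1)).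

Lemma f_shiftedE l : f_shifted l = linear_extensions _ (0, 0) box_lt (diagram l).
Proof.
rewrite /f_shifted /linear_extensions size_diagram; apply: eq_count => t.
have orE A B C : (A ==> C) && (B ==> C) = (A || B ==> C) by case: A; case: B; case: C.
by do 2!apply: eq_forallb => ?; rewrite orE.
Qed.

(** The last box of a row: rows are indexed from 0 in [i] but from 1 in the diagram. *)
Definition corner (l : seq nat) (i : nat) := (i.+1, i.+1 + nth 0 l i).

Lemma all_decr_nth x l i : all (gtn x) l -> all (gtn x) (decr_nth l i).
Proof.
elim: l i => [|y l IH] [|i] //= /andP[yx h]; last by rewrite yx IH.
by case: eqP => //= _; rewrite h andbT (leq_ltn_trans (leq_pred y)).
Qed.

(** A last row of length 1 needs its own clause: it can be deleted, although past the end of [l] the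
    default part 0 makes the second clause fail. *)
Lemma is_strict_decr l i : is_strict l -> i < size l ->
  is_strict (decr_nth l i) = (nth 0 l i == 1) || ((nth 0 l i.+1).+1 != nth 0 l i).
Proof.
elim: l i => [|x l IH] [|i] // sxl; have := sxl; rewrite is_strict_cons => /and3P[x0 xl sl] il /=.
  case: eqP => // x1; rewrite is_strict_cons sl andbT -ltnS prednK // orFb.
  have -> /= : 1 < x by lia.
  case: l xl sl {IH sxl il} => [|y l] /=; first by lia.
  rewrite is_strict_cons => /andP[yx _] /and3P[_ /allP yl _].
  rewrite (_ : all (gtn x.-1) l = true) ?andbT; last first.
    by apply/allP => z /yl /=; lia.
  lia.
by rewrite is_strict_cons x0 all_decr_nth //= IH.
Qed.

Lemma diagram_decr l i : is_strict l -> i < size l ->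
  [seq b <- diagram l | b != corner l i] = diagram (decr_nth l i).
Proof.
elim: l i => [|x l IH] [|i] // sxl; have := sxl; rewrite is_strict_cons => /and3P[x0 xl sl] il /=.
  rewrite diagram_cons filter_cat; have -> : [seq b <- map shift_box (diagram l) | b != corner (x :: l) 0] = map shift_box (diagram l).
    apply/all_filterP/allP => _ /mapP[[i j] hb ->]; move: hb; rewrite mem_diagram => /andP[i0 _].
    by rewrite /corner /shift_box xpair_eqE /=; case: i i0.
  have row : [seq b <- [seq (1, j) | j <- iota 2 x] | b != corner (x :: l) 0] = [seq (1, j) | j <- iota 2 x.-1].
    rewrite /corner [nth _ _ _]/=; case: (x) x0 => // y _.
    rewrite -[X in iota 2 X]addn1 iotaD map_cat filter_cat.
    have -> : 2 + y = 1 + y.+1 by lia.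
    rewrite [X in _ ++ X]/= eqxx cats0; apply/all_filterP/allP => _ /mapP[j hj ->].
    by move: hj; rewrite mem_iota xpair_eqE /=; lia.
  rewrite row; case: eqP => [x1|_]; last by rewrite diagram_cons.
  by have := size_strict _ _ sxl; rewrite x1; case: (l).
rewrite !diagram_cons filter_cat; congr (_ ++ _).
  by apply/all_filterP/allP => _ /mapP[j _ ->]; rewrite /corner xpair_eqE.
by rewrite filter_map -IH.
Qed.

(** A box inside a row has a right neighbour, and a row end has a box below it when the next row is
    one shorter. Conversely, if the row can be shortened, all later rows end before its last column,
    by [strict_part_anti]. *)
Lemma maximal_box l b : is_strict l -> b \in diagram l ->
  all (fun b' => ~~ box_lt b b') (diagram l)
  = (b \in [seq corner l i | i <- iota 0 (size l) & is_strict (decr_nth l i)]).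
Proof.
case: b => i j sl bD; have := bD; rewrite mem_diagram => /and3P[i0 ij ji].
have il : i <= size l.
  by rewrite leqNgt; apply/negP => h; move: ji; rewrite /part; case: (i) i0 ij h => // k _ h1 h2; rewrite nth_default // addn0; lia.
case: i => // i in i0 ij ji il bD *; rewrite /= in ji.
apply/allP/mapP => [hmax|[k]].
  have jE : j = i.+1 + nth 0 l i.
    apply/eqP; rewrite eqn_leq ji leqNgt; apply/negP => hj.
    have : (i.+1, j.+1) \in diagram l by rewrite mem_diagram /=; lia.
    by move/hmax; rewrite /box_lt /= eqxx ltnSn.
  exists i; last by rewrite /corner jE.
  rewrite mem_filter mem_iota il !andbT is_strict_decr //; apply/norP => -[x1 /negPn/eqP e].
  have : (i.+2, j) \in diagram l by rewrite mem_diagram /=; lia.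
  by move/hmax; rewrite /box_lt /= eqxx ltnSn orbT.
rewrite mem_filter mem_iota => /and3P[sd _ kl] [ik jE]; move: sd; rewrite -{}ik in kl jE *.
rewrite is_strict_decr // => sd [i' j']; rewrite mem_diagram => /and3P[i'0 ij' ji'].
apply/negP; rewrite /box_lt /= => /orP[/andP[/eqP ii' jj']|/andP[/eqP jj' ii']].
  by move: ji'; rewrite -ii' /=; lia.
have i'l : i' <= size l.
  by rewrite leqNgt; apply/negP => h; move: ji'; rewrite /part; case: (i') i'0 ij' h => // m _ h1 h2; rewrite nth_default // addn0; lia.
have := strict_part_anti l i.+2 i' sl; rewrite ii' i'l => /(_ isT isT) /= h.
have := strict_part_anti l i.+1 i.+2 sl; rewrite leqnSn => /(_ isT) /=.
have -> : i.+1 < size l by lia.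
move=> /(_ isT); lia.
Qed.

(** The largest entry of a tableau sits in a removable corner; deleting that box leaves a tableau of
    the smaller shape. *)
Lemma f_shifted_rec l : is_strict l -> 0 < size l ->
  f_shifted l
  = \sum_(i <- iota 0 (size l) | is_strict (decr_nth l i)) f_shifted (decr_nth l i).
Proof.
move=> sl l0; have UD := diagram_uniq l.
have D0 : 0 < size (diagram l) by rewrite size_diagram (leq_trans l0) ?size_le_sumn.
rewrite f_shiftedE linear_extensions_rec //.
have delE p : p < size (diagram l) ->
  delete _ p (diagram l) = [seq b <- diagram l | b != nth (0, 0) (diagram l) p].
  move=> pD; rewrite -rem_filter // remE index_uniq //.
transitivity (\sum_(b <- diagram l | all (fun y => ~~ box_lt b y) (diagram l))
   linear_extensions _ (0, 0) box_lt [seq c <- diagram l | c != b]).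
  rewrite [RHS](big_nth (0, 0)) /index_iota subn0 big_seq_cond [RHS]big_seq_cond.
  by apply: eq_bigr => p /andP[]; rewrite mem_iota => pD _; rewrite delE.
transitivity (\sum_(b <- [seq corner l i | i <- iota 0 (size l) & is_strict (decr_nth l i)])
   linear_extensions _ (0, 0) box_lt [seq c <- diagram l | c != b]).
  rewrite -big_filter; apply: perm_big; apply: uniq_perm; first by rewrite filter_uniq.
    by rewrite map_inj_uniq ?filter_uniq ?iota_uniq // => i j [].
  move=> b; rewrite mem_filter; case: (boolP (b \in diagram l)) => bD.
    by rewrite maximal_box ?andbT.
  rewrite andbF; apply/esym/negP => /mapP[i]; rewrite mem_filter mem_iota => /and3P[_ _ il] e.
  move/negP: bD; apply; rewrite e mem_diagram /= leqnn andbT.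
  have : 0 < nth 0 l i by case/andP: sl => _ /allP; apply; apply: mem_nth.
  lia.
rewrite big_map big_filter big_seq_cond [RHS]big_seq_cond; apply: eq_bigr => i /andP[].
by rewrite mem_iota => il _; rewrite f_shiftedE diagram_decr.
Qed.
End ShiftedTableaux.

(** * The Markov chain *)

Section Expectation.

Definition steps (l : seq nat) : seq nat := [seq i <- iota 0 (size l).+1 | is_strict (incr_nth l i)].

Lemma mem_steps l i : (i \in steps l) = up_step l i.
Proof. by rewrite mem_filter mem_iota add0n ltnS leq0n andTb andbC. Qed.

(* By [residue_incr], [res l (nth 0 l i)] equals [2 ^ (i < size l) * H_l / H_l']
   for [l' = incr_nth l i]: these are the transition probabilities of a Markov
   chain on strict partitions. *)
Definition step_mean (l : seq nat) (G : nat -> rat) : rat :=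
  \sum_(i <- steps l) res l (nth 0%N l i) * G i.

(** Blocked rows have residue 0, so the sum may run over all indices up to [size l], the last of
    which stands for the pole at 0. *)
Lemma step_mean_outer l m : is_strict l ->
  step_mean l (fun i => outer (nth 0%N l i) ^+ m) = M l m.
Proof.
move=> sl; rewrite /step_mean big_filter big_mkcond.
have pl : perm_eq (0%N :: l) (rcons l 0%N) by rewrite perm_sym perm_rcons.
rewrite /moment [RHS](perm_big _ pl) [RHS](big_nth 0%N).
rewrite /index_iota subn0 size_rcons big_seq [RHS]big_seq; apply: eq_bigr => i.
rewrite mem_iota add0n ltnS /= => il.
have -> : nth 0%N (rcons l 0%N) i = nth 0%N l i.
  by rewrite nth_rcons; case: ltngtP il => // -> _; rewrite nth_default.
by case: ifPn => // h; rewrite residue_blocked // mul0r.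
Qed.

Definition mass (l : seq nat) : rat :=
  (2 ^ (sumn l - size l))%N%:R * (f_shifted l)%:R / (Hprod l)%:R.

Definition expectation (g : seq nat -> rat) (n : nat) : rat :=
  \sum_(l <- strict_parts n) mass l * g l.

Lemma Hprod_neq0 l : (Hprod l)%:R != 0 :> rat.
Proof.
rewrite pnatr_eq0 -lt0n; apply: prodn_gt0 => b.
by rewrite /hook addn1 addSn.
Qed.

(** Double counting of the pairs of partitions that differ by one box: [incr_nth] and [decr_nth] are
    inverse bijections between the two index sets. *)
Lemma up_down_exchange n (G : nat -> seq nat -> seq nat -> rat) :
  \sum_(l <- strict_parts n.+1) \sum_(i <- iota 0 (size l) | is_strict (decr_nth l i)) G i (decr_nth l i) l
  = \sum_(l <- strict_parts n) \sum_(i <- steps l) G i l (incr_nth l i).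
Proof.
pose down := [seq (i, l) | l <- strict_parts n.+1, i <- [seq i <- iota 0 (size l) | is_strict (decr_nth l i)]].
pose up := [seq (i, l) | l <- strict_parts n, i <- steps l].
transitivity (\sum_(p <- down) G p.1 (decr_nth p.2 p.1) p.2).
  by rewrite big_allpairs_dep /=; apply: eq_bigr => l _; rewrite big_filter.
transitivity (\sum_(p <- up) G p.1 p.2 (incr_nth p.2 p.1)); last by rewrite big_allpairs_dep.
have mem_down i l : ((i, l) \in down) = [&& is_strict l, sumn l == n.+1 & down_step l i].
  apply/allpairsPdep/idP => [[l' [i' []]]|/and3P[sl sn /andP[il sd]]].
    rewrite mem_strict_parts mem_filter mem_iota add0n => /andP[sl sn] /andP[sd /= il] [-> ->].
    by rewrite sl sn /down_step il.
  by exists l, i; rewrite mem_strict_parts mem_filter mem_iota sl sn sd il.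
have mem_up i l : ((i, l) \in up) = [&& is_strict l, sumn l == n & up_step l i].
  apply/allpairsPdep/idP => [[l' [i' []]]|/and3P[sl sn su]].
    by rewrite mem_strict_parts mem_steps => /andP[sl sn] su [-> ->]; rewrite sl sn.
  by exists l, i; rewrite mem_strict_parts mem_steps sl sn.
have up_uniq : uniq up.
  apply: allpairs_uniq_dep => [|l _|[l i] [l' i'] _ _ [-> ->]] //; first exact: strict_parts_uniq.
  by rewrite filter_uniq ?iota_uniq.
have down_uniq : uniq down.
  apply: allpairs_uniq_dep => [|l _|[l i] [l' i'] _ _ [-> ->]] //; first exact: strict_parts_uniq.
  by rewrite filter_uniq ?iota_uniq.
have pud : perm_eq down [seq (p.1, incr_nth p.2 p.1) | p <- up].
  apply: uniq_perm => //.
    rewrite map_inj_in_uniq // => -[i l] [i' l'].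
    rewrite !mem_up /= => /and3P[sl _ /andP[il _]] /and3P[sl' _ /andP[il' _]] [e1].
    by rewrite -e1 in il' * => /(congr1 (decr_nth^~ i)); rewrite !incr_nthK // => ->.
  move=> [i l]; rewrite mem_down; apply/and3P/mapP => [[sl /eqP sn /andP[il sd]]|[[i' l']]].
    exists (i, decr_nth l i); rewrite /= ?decr_nthK // mem_up sd /up_step decr_nthK // sl size_decr_nth //.
    by have := sumn_incr_nth (decr_nth l i) i; rewrite decr_nthK // sn => -[->]; rewrite eqxx.
  rewrite mem_up => /and3P[sl' /eqP sn /andP[il' su]] [-> ->] /=.
  by rewrite sumn_incr_nth sn /down_step size_incr_nth_gt incr_nthK.
rewrite (perm_big _ pud) big_map big_seq [RHS]big_seq; apply: eq_bigr => -[i l].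
by rewrite mem_up => /and3P[sl _ /andP[il _]] /=; rewrite incr_nthK.
Qed.

(** The branching rule expands the tableau count at level [n.+1], the sum is regrouped by the
    smaller partition, and [residue_incr] identifies the quotient of the weights. *)
Lemma expectation_succ g n :
  expectation g n.+1 = expectation (fun l => step_mean l (fun i => g (incr_nth l i))) n.
Proof.
transitivity (\sum_(l <- strict_parts n.+1)
  \sum_(i <- iota 0 (size l) | is_strict (decr_nth l i))
    (2 ^ (sumn l - size l))%N%:R * (f_shifted (decr_nth l i))%:R / (Hprod l)%:R * g l).
  rewrite /expectation big_seq [RHS]big_seq; apply: eq_bigr => l.
  rewrite mem_strict_parts => /andP[sl /eqP sn].
  rewrite /mass f_shifted_rec //; last by case: (l) sn.
  by rewrite natr_sum mulr_sumr !mulr_suml.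
rewrite (up_down_exchange n (fun i l l' => (2 ^ (sumn l' - size l'))%N%:R * (f_shifted l)%:R / (Hprod l')%:R * g l')).
rewrite /expectation big_seq [RHS]big_seq; apply: eq_bigr => l; rewrite mem_strict_parts => /andP[sl /eqP sn].
rewrite /step_mean mulr_sumr big_seq [RHS]big_seq; apply: eq_bigr => i.
rewrite mem_steps => su; rewrite [RHS]mulrA; congr (_ * _).
have := residue_incr l i sl su; have := Hprod_neq0 l; have := Hprod_neq0 (incr_nth l i).
(* Size minus length grows by one when a row is extended and is unchanged when a row is started. *)
have -> : (2 ^ (sumn (incr_nth l i) - size (incr_nth l i)) = 2 ^ (sumn l - size l) * 2 ^ (i < size l))%N.
  rewrite -expnD sumn_incr_nth size_incr_nth; have := size_le_sumn l sl; case/andP: su => il _.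
  by move=> sz; congr (2 ^ _)%N; case: ltnP => h /=; lia.
rewrite natrM /mass => H1 H2 e.
have -> : res l (nth 0%N l i) = (2 ^ (i < size l))%N%:R * (Hprod l)%:R / (Hprod (incr_nth l i))%:R.
  by rewrite e mulfK.
by field; rewrite H1 H2.
Qed.

End Expectation.

(** * Moments along the chain *)

Section MomentSteps.

Lemma uniq0_notin x s : uniq [:: 0, x & s]%N -> x \notin 0%N :: s.
Proof.
by move=> U; have := perm_uniq (perm_swap 0%N x s); rewrite U => /esym/andP[].
Qed.

(** A part [t] adds [outer t - inner t = 2 t] to the first moment, which is therefore twice the size
    of [l]. *)
Lemma moment_incr1 l i : is_strict l -> up_step l i -> M (incr_nth l i) 1 = M l 1 + 2.
Proof.
move=> sl /andP[]; rewrite leq_eqVlt => /orP[/eqP->|il] sl'.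
  have pl : perm_eq (incr_nth l (size l)) (1%N :: l) by rewrite incr_nth_rcons perm_rcons.
  have U : uniq [:: 0, 1 & l]%N.
    by rewrite -(perm_uniq (s1 := 0%N :: incr_nth l (size l))) ?perm_cons ?is_strict_uniq.
  have Ul := is_strict_uniq l sl.
  rewrite (moment_perm _ _ _ _ _ _ _ _ pl) moment_nat_cons ?uniq0_notin // !moment_nat0 //.
  by rewrite /outer /inner; ring.
have [pl pl'] := perm_incr_nth l i il; move: pl pl'; set x := nth _ _ _; set s := _ ++ _ => pl pl'.
have U : uniq [:: 0, x & s]%N.
  by rewrite -(perm_uniq (s1 := 0%N :: l)) ?perm_cons ?is_strict_uniq.
have U' : uniq [:: 0, x.+1 & s]%N.
  by rewrite -(perm_uniq (s1 := 0%N :: incr_nth l i)) ?perm_cons ?is_strict_uniq.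
have Us : uniq (0%N :: s) by move: U; rewrite !cons_uniq inE negb_or => /and3P[/andP[_ ->] _ ->].
rewrite (moment_perm _ _ _ _ _ _ _ _ pl') (moment_perm _ _ _ _ _ _ _ _ pl).
rewrite !moment_nat_cons ?uniq0_notin // !moment_nat0 //.
by rewrite /outer /inner -natr1; ring.
Qed.

Lemma moment_incr2 l i m : is_strict l -> up_step l i ->
  let y := outer (nth 0%N l i) in
  M (incr_nth l i) m.+2
  = (2 * y + 2) * M (incr_nth l i) m.+1 - (y ^+ 2 - 2 * y) * M (incr_nth l i) m
    + M l m.+2 - 2 * y * M l m.+1 + y ^+ 2 * M l m.
Proof.
move=> sl /andP[]; rewrite leq_eqVlt => /orP[/eqP->|il] sl'.
  have pl : perm_eq (incr_nth l (size l)) (1%N :: l) by rewrite incr_nth_rcons perm_rcons.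
  have U : uniq [:: 0, 1 & l]%N.
    by rewrite -(perm_uniq (s1 := 0%N :: incr_nth l (size l))) ?perm_cons ?is_strict_uniq.
  (* A new row is the case [y = 0], where the recurrence is the one for inserting the part 1, with
     [outer 1 = 2] and [inner 1 = 0]. *)
  rewrite nth_default //= !(moment_perm _ _ _ _ _ _ _ _ pl).
  rewrite [in LHS]moment_nat_cons ?uniq0_notin // /outer /inner; ring.
have [pl pl'] := perm_incr_nth l i il; move: pl pl'; set x := nth _ _ _; set s := _ ++ _ => pl pl'.
have U : uniq [:: 0, x & s]%N.
  by rewrite -(perm_uniq (s1 := 0%N :: l)) ?perm_cons ?is_strict_uniq.
have U' : uniq [:: 0, x.+1 & s]%N.
  by rewrite -(perm_uniq (s1 := 0%N :: incr_nth l i)) ?perm_cons ?is_strict_uniq.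
rewrite /= !(moment_perm _ _ _ _ _ _ _ _ pl') !(moment_perm _ _ _ _ _ _ _ _ pl).
exact: moment_step.
Qed.
End MomentSteps.

(** * Degree filtration and finite differences *)

Section Filtration.

(* Weighted degree: the moment [M _ m] has degree [m]. *)
Inductive filt : nat -> (seq nat -> rat) -> Prop :=
| filt_const d c : filt d (fun=> c)
| filt_moment m : filt m (fun l => M l m)
| filt_add d g h : filt d g -> filt d h -> filt d (fun l => g l + h l)
| filt_mul d e g h : filt d g -> filt e h -> filt (d + e) (fun l => g l * h l)
| filt_mono d e g : (d <= e)%N -> filt d g -> filt e g
| filt_ext d g h : (forall l, is_strict l -> g l = h l) -> filt d g -> filt d h.

Lemma filt_sum d (I : Type) (r : seq I) (g : I -> seq nat -> rat) :
  (forall i, filt d (g i)) -> filt d (fun l => \sum_(i <- r) g i l).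
Proof.
move=> hg; elim: r => [|i r IH].
  by apply: filt_ext (filt_const d 0) => l _; rewrite big_nil.
by apply: filt_ext (filt_add _ _ _ (hg i) IH) => l _; rewrite big_cons.
Qed.

(* [pfilt d F]: counting the polynomial variable with degree 1, [F] has degree
   at most [d - 1]; in particular [F] vanishes when [d = 0]. *)
Definition pfilt (d : nat) (F : seq nat -> {poly rat}) :=
  forall j, ((j < d)%N -> filt (d.-1 - j) (fun l => (F l)`_j))
         /\ ((d <= j)%N -> forall l, (F l)`_j = 0).

Lemma pfilt_mono d e F : (d <= e)%N -> pfilt d F -> pfilt e F.
Proof.
move=> de hF j; have [h1 h2] := hF j; split=> hj; last by apply: h2; lia.
case: (ltnP j d) => jd; first by apply: filt_mono (h1 jd); lia.
by apply: filt_ext (filt_const _ 0) => l _; rewrite h2.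
Qed.

Lemma pfilt0 d : pfilt d (fun=> 0).
Proof.
move=> j; split=> [_|_ l]; last by rewrite coef0.
by apply: filt_ext (filt_const _ 0) => l _; rewrite coef0.
Qed.

Lemma pfilt_add d F G : pfilt d F -> pfilt d G -> pfilt d (fun l => F l + G l).
Proof.
move=> hF hG j; have [h1 h2] := hF j; have [h3 h4] := hG j.
split=> hj => [|l]; last by rewrite coefD h2 ?h4 ?addr0.
by apply: filt_ext (filt_add _ _ _ (h1 hj) (h3 hj)) => l _; rewrite coefD.
Qed.

(** Degrees at most [d] and [e - 1] add up to [d + e - 1]; the asymmetric bounds keep the case
    [e = 0], where [G] vanishes. *)
Lemma pfilt_mul d e F G : pfilt d.+1 F -> pfilt e G -> pfilt (d + e) (fun l => F l * G l).
Proof.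
move=> hF hG k; split=> hk => [|l]; last first.
  rewrite coefM big1 // => -[i ik] _ /=.
  have [_ h] := hF i; have [_ h'] := hG (k - i)%N.
  case: (ltnP d i) => di; first by rewrite h ?mul0r.
  by rewrite h' ?mulr0 //; lia.
apply: filt_ext (filt_sum _ _ (index_enum 'I_k.+1) (fun i l => (F l)`_i * (G l)`_(k - i)) _) => [l _|[i ik] /=].
  by rewrite coefM.
have [h1 h2] := hF i; have [h3 h4] := hG (k - i)%N.
case: (ltnP d i) => di.
  by apply: filt_ext (filt_const _ 0) => l _; rewrite h2 ?mul0r.
case: (ltnP (k - i) e) => ke.
  apply: filt_mono (filt_mul _ _ _ _ (h1 _) (h3 ke)) => //=; lia.
by apply: filt_ext (filt_const _ 0) => l _; rewrite h4 ?mulr0.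
Qed.

Lemma pfilt_filt d g : filt d g -> pfilt d.+1 (fun l => (g l)%:P).
Proof.
move=> hg j; split=> hj => [|l]; last by rewrite coefC gtn_eqF //; lia.
case: j hj => [|j] hj.
  by rewrite subn0; apply: filt_ext hg => l _; rewrite coefC.
by apply: filt_ext (filt_const _ 0) => l _; rewrite coefC.
Qed.

Lemma pfilt_poly (q : {poly rat}) d : (size q <= d)%N -> pfilt d (fun=> q).
Proof.
move=> sq j; split=> hj => [|l]; first exact: filt_const.
by rewrite nth_default //; apply: leq_trans hj.
Qed.

Definition increments (d : nat) (g : seq nat -> rat) :=
  exists2 F, pfilt d F & forall l i, is_strict l -> up_step l i ->
    g (incr_nth l i) = g l + (F l).[outer (nth 0%N l i)].

(** Two consecutive moments are treated together because [moment_incr2] is a two-step recurrence. *)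
Lemma increments_moment m : increments m (fun l => M l m) /\ increments m.+1 (fun l => M l m.+1).
Proof.
elim: m => [|m [[F hF eF] [G hG eG]]].
  split.
    exists (fun=> 0) => [|l i sl su]; first exact: pfilt0.
    by rewrite horner0 addr0 !moment_nat0 ?is_strict_uniq //; case/andP: su.
  exists (fun=> 2%:P) => [|l i sl su]; first by apply: pfilt_poly; rewrite size_polyC.
  by rewrite hornerC moment_incr1.
split; first by exists G.
(* Obtained by substituting the increments [F] and [G] into [moment_incr2]. The terms of top degree,
   ['X ^+ 2] times the moment [m] and ['X] times twice the moment [m.+1], cancel. *)
exists (fun l => ('X *+ 2 + 2%:P) * G l + ('X *+ 2 - 'X ^+ 2) * F l
               + (2%:P * (M l m.+1)%:P + ('X *+ 2) * (M l m)%:P)).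
  have s2X : (size ('X *+ 2 : {poly rat}) <= 2)%N by rewrite -scaler_nat (leq_trans (size_scale_leq _ _)) ?size_polyX.
  apply: pfilt_add; first apply: pfilt_add.
  - apply: (pfilt_mul 1) hG; apply: pfilt_poly.
    by rewrite (leq_trans (size_polyD _ _)) // geq_max s2X (leq_trans (size_polyC_leq1 _)).
  - apply: (pfilt_mul 2) hF; apply: pfilt_poly.
    by rewrite (leq_trans (size_polyD _ _)) // geq_max size_polyN size_polyXn (leq_trans s2X).
  apply: pfilt_add.
    apply: (pfilt_mul 0); first by apply: pfilt_poly; rewrite size_polyC.
    exact: pfilt_filt (filt_moment _).
  apply: (pfilt_mul 1); first exact: pfilt_poly.
  exact: pfilt_filt (filt_moment _).
move=> l i sl su; rewrite moment_incr2 // eF // eG //.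
by rewrite !(hornerD, hornerM, hornerN, hornerMn, hornerXn, hornerX, hornerC); ring.
Qed.

Lemma filt_increments d g : filt d g -> increments d g.
Proof.
elim=> {d g} [d c|m|d g h _ [F hF eF] _ [G hG eG]|d e g h hg [F hF eF] hh [G hG eG]
  |d e g de _ [F hF eF]|d g h gh _ [F hF eF]].
- exists (fun=> 0) => [|l i sl su]; first exact: pfilt0.
  by rewrite horner0 addr0.
- by case: (increments_moment m).
- exists (fun l => F l + G l) => [|l i sl su]; first exact: pfilt_add.
  by rewrite eF // eG // hornerD addrACA.
(* The increment of a product, by the discrete Leibniz rule. *)
- exists (fun l => (g l)%:P * G l + ((h l)%:P * F l + F l * G l)) => [|l i sl su].
    apply: pfilt_add; first by apply: pfilt_mul => //; apply: pfilt_filt.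
    apply: pfilt_add; first by rewrite addnC; apply: pfilt_mul => //; apply: pfilt_filt.
    by apply: pfilt_mul => //; apply: pfilt_mono hF.
  by rewrite eF // eG // !(hornerD, hornerM, hornerC); ring.
- by exists F => //; apply: pfilt_mono hF.
- exists F => // l i sl su; rewrite -!gh ?eF //; by case/andP: su.
Qed.

(** Averaging replaces the power [j] of the variable by the moment [j], by [step_mean_outer], and
    both count as degree [j]. *)
Lemma filt_step_mean d F : pfilt d.+1 F ->
  filt d (fun l => step_mean l (fun i => (F l).[outer (nth 0%N l i)])).
Proof.
move=> hF; apply: filt_ext (filt_sum _ _ (index_enum 'I_d.+1) (fun j l => (F l)`_j * M l j) _) => [l sl|[j jd] /=].
  rewrite /step_mean; under [RHS]eq_bigr => i _.
    rewrite (@horner_coef_wide _ d.+1); last by apply/leq_sizeP => j dj; have [_ ->] := hF j.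
    rewrite mulr_sumr; over.
  rewrite exchange_big /=; apply: eq_bigr => j _.
  rewrite -step_mean_outer // /step_mean mulr_sumr; apply: eq_bigr => i _; ring.
have [h _] := hF j; have /= := filt_mul _ _ _ _ (h jd) (filt_moment j).
by rewrite subnK.
Qed.

(** The finite difference of order [d] is identically zero: [s] is polynomial of degree less than
    [d]. *)
Fixpoint diff_vanish (d : nat) (s : nat -> rat) : Prop :=
  if d is d'.+1 then diff_vanish d' (fun n => s n.+1 - s n) else forall n, s n = 0.

Lemma diff_vanish_ext d s t : s =1 t -> diff_vanish d s -> diff_vanish d t.
Proof.
elim: d s t => [|d IH] s t st /= hs; first by move=> n; rewrite -st.
by apply: IH hs => n; rewrite !st.
Qed.

(** Newton's forward difference formula with a single surviving term. The difference sequence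
    satisfies the hypotheses one degree lower, and Pascal's rule sums it up. *)
Lemma diff_vanish_eq d s n : diff_vanish d.+1 s -> (forall m, (m < d)%N -> s m = 0) ->
  s n = s d * 'C(n, d)%:R.
Proof.
elim: d s n => [|d IH] s n hs h0.
  rewrite bin0 mulr1; elim: n => // n IHn.
  by have /= /(_ n)/eqP := hs; rewrite subr_eq0 => /eqP ->.
have hd m : s m.+1 = s m + s d.+1 * 'C(m, d)%:R.
  have -> : s d.+1 = s d.+1 - s d by rewrite [s d]h0 ?subr0.
  rewrite -(IH (fun n => s n.+1 - s n) m) //; first by ring.
  by move=> k kd; rewrite !h0 ?subrr //; lia.
elim: n => [|n IHn]; first by rewrite bin0n mulr0 h0.
by rewrite hd {1}IHn -mulrDr -natrD binS addnC.
Qed.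

Lemma step_mean1 l : is_strict l -> step_mean l (fun=> 1) = 1.
Proof. by move=> sl; rewrite (step_mean_outer l 0 sl) moment_nat0 ?is_strict_uniq. Qed.

Lemma expectation_diff g F n :
  (forall l i, is_strict l -> up_step l i -> g (incr_nth l i) = g l + (F l).[outer (nth 0%N l i)]) ->
  expectation g n.+1 - expectation g n = expectation (fun l => step_mean l (fun i => (F l).[outer (nth 0%N l i)])) n.
Proof.
move=> gF; rewrite expectation_succ /expectation -sumrB big_seq [RHS]big_seq; apply: eq_bigr => l.
rewrite mem_strict_parts => /andP[sl _]; rewrite -mulrBr; congr (_ * _).
rewrite -[g l]mulr1 -(step_mean1 _ sl) /step_mean mulr_sumr -sumrB big_seq [RHS]big_seq.
by apply: eq_bigr => i; rewrite mem_steps => su; rewrite gF //; ring.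
Qed.

(** The difference in [n] is the expectation of the mean increment, whose degree is one lower; in
    degree 0 the increment is zero. *)
Lemma expectation_filt d g : filt d g -> diff_vanish d.+1 (expectation g).
Proof.
elim: d g => [|d IH] g /filt_increments[F hF eF].
  move=> n /=; rewrite (expectation_diff _ _ _ eF) /expectation big1 // => l _; rewrite /step_mean big1 ?mulr0 // => i _.
  suff -> : F l = 0 by rewrite horner0 mulr0.
  by apply/polyP => j; rewrite coef0; have [_ ->] := hF j.
have := IH _ (filt_step_mean _ _ hF); apply: diff_vanish_ext => n.
by rewrite (expectation_diff _ _ _ eF).
Qed.

End Filtration.

(** * Binomials of contents *)

Section Contents.

(** The product of the ['X - j (j + 1)] for [j < k], divided by [(2k)!]. At [outer x] the factors of
    ['C(x + k, 2 * k)] pair up as [(x + j + 1) (x - j) = x (x + 1) - j (j + 1)]. *)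
Fixpoint content_poly (k : nat) : {poly rat} :=
  if k is k'.+1 then
    ((2 * k').+1%:R * (2 * k').+2%:R)^-1 *: (content_poly k' * ('X - (k' * k'.+1)%:R%:P))
  else 1.

Lemma size_content_poly k : (size (content_poly k) <= k.+1)%N.
Proof.
elim: k => [|k IH] /=; first by rewrite size_poly1.
apply: leq_trans (size_scale_leq _ _) _; apply: leq_trans (size_polyMleq _ _) _.
by rewrite size_XsubC addn2.
Qed.

Lemma content_polyE k x : (content_poly k).[outer x] = 'C(x + k, 2 * k)%:R.
Proof.
elim: k => [|k IH] /=; first by rewrite hornerC muln0 bin0.
rewrite hornerZ hornerM hornerXsubC IH.
have e : ('C(x + k.+1, 2 * k.+1) * ((2 * k).+1 * (2 * k).+2) + 'C(x + k, 2 * k) * (k * k.+1) = 'C(x + k, 2 * k) * (x * x.+1))%N.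
  have e1 := mul_bin_diag (x + k).+1 (2 * k).+1; have e2 := mul_bin_left (x + k) (2 * k).
  rewrite (_ : 2 * k.+1 = (2 * k).+2)%N ?addnS; last by lia.
  (* For [x < k] the natural subtraction [x + k - 2 k] would truncate, but both binomials vanish. *)
  case: (ltnP x k) => xk; first by rewrite !bin_small //; lia.
  rewrite [X in (X + _)%N]mulnC -mulnA -e1 /= mulnCA e2 mulnA [X in (X + _)%N]mulnC -mulnDr.
  congr (_ * _)%N; have -> : (x + k - 2 * k = x - k)%N by lia.
  by rewrite -(subnKC xk) addKn; nia.
have := congr1 (fun n => n%:R : rat) e; rewrite /= !natrD !natrM => {}e.
have k1 : (2 * k).+1%:R != 0 :> rat by rewrite pnatr_eq0.
have k2 : (2 * k).+2%:R != 0 :> rat by rewrite pnatr_eq0.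
apply: (mulfI (mulf_neq0 k1 k2)); rewrite mulrA mulfV ?mulf_neq0 // mul1r.
rewrite /outer natr1 mulrBr -e; ring.
Qed.

Lemma sum_incr_nth (F : nat -> rat) l i : (i <= size l)%N ->
  \sum_(x <- incr_nth l i) \sum_(1 <= c < x.+1) F c
  = \sum_(x <- l) \sum_(1 <= c < x.+1) F c + F (nth 0%N l i).+1.
Proof.
elim: l i => [|x l IH] [|i] // il; rewrite [incr_nth _ _]/= [nth _ _ _]/=.
- by rewrite big_seq1 big_nat1 big_nil add0r.
- by rewrite [LHS]big_cons (big_nat_recr x.+1) //= [in RHS]big_cons addrAC.
- by rewrite !big_cons IH // addrA.
Qed.

End Contents.

(** * The expected binomial content sum *)

Section BinomialContentSum.
Variable k : nat.

Definition binomial_content_sum (l : seq nat) : nat :=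
  (\sum_(b <- diagram l) 'C(content b + k - 1, 2 * k))%N.

Lemma binomial_content_sumE l :
  (binomial_content_sum l)%:R
  = \sum_(x <- l) \sum_(1 <= c < x.+1) 'C(c + k - 1, 2 * k)%:R :> rat.
Proof. by rewrite natr_sum (big_content_diagram _ (fun c => 'C(c + k - 1, 2 * k)%:R)). Qed.

Lemma binomial_content_sum_incr l i : up_step l i ->
  (binomial_content_sum (incr_nth l i))%:R
  = (binomial_content_sum l)%:R + (content_poly k).[outer (nth 0%N l i)].
Proof.
case/andP=> il _; rewrite !binomial_content_sumE sum_incr_nth //.
by rewrite content_polyE addSn subn1.
Qed.

(** The increment of the sum is the fixed polynomial [content_poly k], so its mean lies in degree
    [k]. The difference in [n] of the expectation then has degree at most [k], and the expectation
    at most [k + 1]. *)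
Lemma expectation_binomial_content_sum_diff :
  diff_vanish k.+2 (expectation (fun l => (binomial_content_sum l)%:R)).
Proof.
have h := filt_step_mean k _ (pfilt_poly _ _ (size_content_poly k)).
have := expectation_filt _ _ h; apply: diff_vanish_ext => n.
by rewrite (expectation_diff _ (fun=> content_poly k)) // => l i _; apply: binomial_content_sum_incr.
Qed.

Lemma binomial_content_sum_small l : {in l, forall x, x <= k}%N -> binomial_content_sum l = 0%N.
Proof.
move=> lk; rewrite /binomial_content_sum (big_content_diagram _ (fun c => 'C(c + k - 1, 2 * k))).
rewrite big_seq big1 // => x /lk xk; rewrite big_nat_cond big1 // => c; rewrite andbT => hc.
by rewrite bin_small //; lia.
Qed.

Lemma expectation_binomial_content_sum_small n : (n <= k)%N ->
  expectation (fun l => (binomial_content_sum l)%:R) n = 0.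
Proof.
move=> nk; rewrite /expectation big_seq big1 // => l; rewrite mem_strict_parts => /andP[_ /eqP sn].
rewrite binomial_content_sum_small ?mulr0 // => x /leq_mem_sumn; lia.
Qed.

Lemma strict_full_part l m : is_strict l -> sumn l = m -> m \in l -> l = [:: m].
Proof.
move=> sl <- /perm_to_rem pl; apply: perm_small_eq => //.
case E : (rem (sumn l) l) pl => [|x r] // pl.
have x0 : (0 < x)%N.
  by case/andP: sl => _ /allP; apply; rewrite (perm_mem pl) !inE eqxx orbT.
by have /= := perm_sumn pl; lia.
Qed.

Lemma f_shifted_row m : f_shifted [:: m] = 1%N.
Proof.
have f0 : f_shifted [::] = 1%N.
  rewrite /f_shifted (_ : permutations _ = [:: [::]]) //= addn0.
  by rewrite (_ : standard_filling _ _) //; apply/forallP => -[].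
elim: m => [|m IH]; first by rewrite -f0.
by rewrite f_shifted_rec //= big_cons big_nil /=; case: m IH => [|m] /= IH; rewrite ?f0 ?IH.
Qed.

Lemma mass_row m : mass [:: m.+1] = (2 ^ m)%N%:R / (m.+1)`!%:R.
Proof.
rewrite /mass f_shifted_row mulr1 Hprod_cons_rat // /Hprod !big_nil /= addn0 subn1.
by rewrite mul1r mulr1.
Qed.

Lemma expectation_binomial_content_sum_diag :
  expectation (fun l => (binomial_content_sum l)%:R) k.+1 = (2 ^ k)%N%:R / (k.+1)`!%:R.
Proof.
have row_mem : [:: k.+1] \in strict_parts k.+1 by rewrite mem_strict_parts /= addn0 eqxx.
(* Every partition of [k.+1] other than the single row has all parts at most [k], so its content sum
   vanishes. *)
rewrite /expectation (bigD1_seq _ row_mem (strict_parts_uniq _)) /= big_seq_cond big1 ?addr0; last first.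
  move=> l /andP[]; rewrite mem_strict_parts => /andP[sl /eqP sn] lk.
  rewrite binomial_content_sum_small ?mulr0 // => x xl; rewrite -ltnS ltn_neqAle -sn leq_mem_sumn // andbT.
  apply: contraNneq lk => xE; apply/eqP; apply: strict_full_part => //.
  by rewrite -sn -xE.
(* In the single row only the last box, of content [k + 1], counts, with ['C(2 * k, 2 * k) = 1]. *)
rewrite mass_row binomial_content_sumE big_seq1 big_nat_recr //= addSn subn1 /= addnn -mul2n.
rewrite big_nat_cond big1 ?add0r ?binn ?mulr1 // => c; rewrite andbT => hc.
by rewrite bin_small //; lia.
Qed.

End BinomialContentSum.

Theorem theorem1p2 (k n : nat) :
  \sum_(l <- strict_parts n)
     ((2 ^ (sumn l - size l))%N%:R * (f_shifted l)%:R / (Hprod l)%:R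
      * (\sum_(b <- diagram l) 'C(content b + k - 1, 2 * k))%N%:R : rat)
  = (2 ^ k)%N%:R / (k.+1)`!%:R * 'C(n, k.+1)%:R.
Proof.
rewrite -expectation_binomial_content_sum_diag.
apply: (diff_vanish_eq _ (expectation (fun l => (binomial_content_sum k l)%:R))) => [|m mk].
  exact: expectation_binomial_content_sum_diff.
exact: expectation_binomial_content_sum_small.
Qed.
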